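(* Let $B = R + \bar\Lambda$ be the $N\times N$ real matrix defined in the context and let $\mathfrak{g} = (e^{g(1)}, \ldots, e^{g(N)})'$ (a column vector). Then the function $w^T : t \in [0,T] \mapsto w^T(t) = e^{B(T-t)}\mathfrak{g} \in \mathbb{R}^N$ satisfies $$\forall i \in \mathcal{N}, \ \forall t \in [0,T], \quad w^T_i(t) > 0,$$ and the function $v^T : t \in [0,T] \mapsto \left(\log(w^T_i(t))\right)_{i \in \mathcal{N}}$ is a solution to the system of ordinary differential equations $$\forall i \in \mathcal{N}, \ \forall t\in[0,T], \quad \frac{d}{dt} V^T_i(t) = - r(i) - \sum_{j \in \mathcal{V}(i)} \bar\lambda_{ij}\left(\exp\left(V^T_j(t) - V^T_i(t)\right) - 1\right)$$ with terminal condition $$\forall i \in \mathcal{N}, \quad V^T_i(T) = g(i).$$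
   Context: Let $T>0$. Let $\mathcal{G}$ be a finite directed graph with no self-loop, with set of nodes $\mathcal{N} = \{1,\ldots,N\}$, where $N \ge 2$ is an integer. For each $i \in \mathcal{N}$, $\mathcal{V}(i) \subset \mathcal{N}\setminus\{i\}$ denotes the set of nodes $j$ for which there is a directed edge from $i$ to $j$. Let $r : \mathcal{N} \to \mathbb{R}$ and $g : \mathcal{N} \to \mathbb{R}$ be functions, and let $(\bar\lambda_{ij})_{i \in \mathcal{N}, j \in \mathcal{V}(i)}$ be a family of positive real numbers. Let $R = \mathrm{diag}(r(1),\ldots,r(N))$, and let $\bar\Lambda$ be the $N \times N$ matrix (infinitesimal generator of the Markov chain with intensities $\bar\lambda_{ij}$) defined by $$\bar\Lambda_{ij} = \begin{cases} \bar\lambda_{ij}, & \text{if } j \in \mathcal{V}(i),\\ -\sum_{k \in \mathcal{V}(i)} \bar\lambda_{ik}, & \text{if } j = i,\\ 0, & \text{otherwise.}\end{cases}$$ Set $B = R + \bar\Lambda$. The symbol $'$ denotes transposition, and $e^{M}$ denotes the exponential of a square matrix $M$. *)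

(* Defs.v *)
From mathcomp Require Import all_boot all_order all_algebra.
From mathcomp Require Import all_classical all_reals all_analysis.

Set Implicit Arguments.
Unset Strict Implicit.
Unset Printing Implicit Defensive.

Import Order.TTheory GRing.Theory Num.Theory.
Import numFieldNormedType.Exports.

Local Open Scope classical_set_scope.
Local Open Scope ring_scope.

(* The limit is taken in the normed topology of 'M[R]_N. *)
Definition expmx (R : realType) (N : nat) (A : 'M[R]_N) : 'M[R]_N :=
  limn (series (fun k : nat => k`!%:R^-1 *: A ^+ k)).

(* A directed graph on 'I_N is given by its out-neighbourhoods V; only the
   values lam i j with j \in V i are used. *)
Definition generator (R : realType) (N : nat) (V : 'I_N -> {set 'I_N})
    (lam : 'I_N -> 'I_N -> R) : 'M[R]_N :=
  \matrix_(i, j) if j \in V i then lam i j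
                 else if j == i then - \sum_(k in V i) lam i k
                 else 0.

(* Derivative relative to D: two-sided at interior points of an interval D,
   one-sided at its endpoints. *)
Definition has_derivative_in (R : realType) (D : set R) (f : R -> R)
    (t l : R) : Prop :=
  (f s - f t) / (s - t) @[s --> within D t^'] --> l.

(* Main.v *)
Require Import Defs.
From mathcomp Require Import all_boot all_order all_algebra.
From mathcomp Require Import all_classical all_reals all_analysis.
From mathcomp Require Import ring.

Set Implicit Arguments.
Unset Strict Implicit.
Unset Printing Implicit Defensive.

Import Order.TTheory GRing.Theory Num.Theory.
Import numFieldNormedType.Exports.

Local Open Scope classical_set_scope.
Local Open Scope ring_scope.

(** For any square matrix [A], the entries of [expmx (t *: A)] are power series
    in [t] that converge everywhere.  Termwise differentiation therefore gives
    [d/dt expmx (t *: A) = A *m expmx (t *: A)] ([is_derive_expmx]), so that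
    [w t = expmx ((T - t) *: B) *m gfrak] solves the linear equation
    [w' = - B *m w] with [w T = gfrak].

    Positivity of [w] comes from the sign pattern of [(T - t) *: B]: off the
    diagonal, the entries of [B] are intensities or zero, and [T - t >= 0].
    For a matrix [A] with nonnegative off-diagonal entries (a Metzler matrix),
    [A + c%:M] is entrywise nonnegative once [c] is large.  The exponential
    series of a nonnegative matrix dominates its first term, the identity, and
    [expmx (A + c%:M) = expR c *: expmx A] ([expmx_shift]); hence [expmx A] is
    bounded below entrywise by a positive multiple of the identity
    ([expmx_Metzler]), and it maps positive vectors to positive ones.

    Finally, the logarithm turns the linear equation into the stated one: the
    rows of the generator sum to zero, so [(B *m w) i] equals
    [r i * w i + \sum_(j in V i) lam i j * (w j - w i)] ([generator_mulmx]).
    Dividing by [w i] leaves the ratios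
    [w j / w i = expR (v j - v i)]. *)

(** * Entrywise convergence of the exponential series *)

Definition expmx_series (R : realType) (N : nat) (A : 'M[R]_N) :
    nat -> 'M[R]_N :=
  series (fun k : nat => k`!%:R^-1 *: A ^+ k).

(** Coefficients of the power series in [t] for the entry [(i, j)] of
    [expmx (t *: A)]. *)
Definition expmx_coeff (R : realType) (N : nat) (A : 'M[R]_N) (i j : 'I_N) :
    R ^nat :=
  fun k => k`!%:R^-1 * (A ^+ k) i j.

(** [exprZn] is about algebras over [R], whose unit is nonzero, and so does not
    apply to matrices of size zero. *)
Lemma exprZmx (R : realType) (N : nat) (t : R) (A : 'M[R]_N) (k : nat) :
  (t *: A) ^+ k = t ^+ k *: A ^+ k.
Proof.
elim: k => [|k IH]; first by rewrite !expr0 scale1r.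
rewrite exprS IH -mulmxE -scalemxAl -scalemxAr scalerA -exprS mulmxE.
by rewrite -exprS.
Qed.

Lemma expmx_seriesE (R : realType) (N : nat) (A : 'M[R]_N) (t : R)
    (i j : 'I_N) (n : nat) :
  expmx_series (t *: A) n i j = pseries (expmx_coeff A i j) t n.
Proof.
rewrite /expmx_series /pseries /series /= summxE; apply: eq_bigr => k _.
by rewrite !mxE exprZmx mxE /expmx_coeff; ring.
Qed.

(** The sum of the absolute values of the entries is a submultiplicative bound;
    it dominates each entry of the exponential series by a term of a scalar
    exponential series. *)
Lemma norm_exprmx_le (R : realType) (N : nat) (A : 'M[R]_N) (k : nat)
    (i j : 'I_N) :
  `|(A ^+ k) i j| <= (\sum_i \sum_j `|A i j|) ^+ k.
Proof.
set M := \sum_i _.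
have M_ge0 : 0 <= M by apply: sumr_ge0 => ? _; exact: sumr_ge0.
elim: k i j => [|k IH] i j.
  by rewrite !expr0 mxE; case: (i == j); rewrite ?normr1 ?normr0.
rewrite exprS -mulmxE mxE (le_trans (ler_norm_sum _ _ _))// exprS.
apply: (@le_trans _ _ (\sum_l `|A i l| * M ^+ k)).
  by apply: ler_sum => l _; rewrite normrM ler_wpM2l.
rewrite -mulr_suml ler_wpM2r ?exprn_ge0//.
rewrite [leRHS](bigD1 i)//= lerDl.
by apply: sumr_ge0 => ? _; exact: sumr_ge0.
Qed.

Lemma is_cvg_expmx_coeff (R : realType) (N : nat) (A : 'M[R]_N)
    (i j : 'I_N) (t : R) :
  cvgn (pseries (expmx_coeff A i j) t).
Proof.
set M := \sum_i \sum_j `|A i j|.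
have M_ge0 : 0 <= M by apply: sumr_ge0 => ? _; exact: sumr_ge0.
apply: normed_cvg.
apply: (series_le_cvg _ _ _ (is_cvg_series_exp_coeff (M * `|t|))) => k /=.
- by [].
- by rewrite /exp_coeff divr_ge0// exprn_ge0// mulr_ge0.
rewrite /expmx_coeff /exp_coeff /= !normrM normfV normr_nat normrX exprMn.
rewrite -mulrA mulrC ler_wpM2r// ?invr_ge0// ler_wpM2r ?exprn_ge0//.
exact: norm_exprmx_le.
Qed.

(** A neighbourhood of a matrix contains a finite product of neighbourhoods of
    its entries. *)
Lemma cvg_mx_entries (R : realType) (m n : nat) (u : nat -> 'M[R]_(m, n))
    (L : 'M[R]_(m, n)) :
  (forall i j, u k i j @[k --> \oo] --> L i j) -> u @ \oo --> L.
Proof.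
move=> uL B [P LP sPB].
have uP : \forall k \near \oo, forall i j, P i j (u k i j).
  apply: filter_forall => i.
  apply: (@filter_forall _ _ (fun j k => P i j (u k i j)) _ _) => j.
  exact: (uL i j _ (LP i j)).
by apply: (filterS _ uP) => k uPk; exact: sPB.
Qed.

(** Since [expmx] is a limit of matrices, its entries are known only once the
    matrix series is shown to converge; after that every property of [expmx]
    passes to the limit entry by entry. *)
Lemma expmx_entry_cvg (R : realType) (N : nat) (A : 'M[R]_N) (i j : 'I_N) :
  expmx_series A n i j @[n --> \oo] --> expmx A i j.
Proof.
pose L : 'M[R]_N := \matrix_(i, j) limn (pseries (expmx_coeff A i j) 1).
have entry i' j' : expmx_series A n i' j' @[n --> \oo] --> L i' j'.
  rewrite mxE (_ : (fun n => _) = pseries (expmx_coeff A i' j') 1).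
    exact: is_cvg_expmx_coeff.
  by apply/funext => n; rewrite -expmx_seriesE scale1r.
suff -> : expmx A = L by [].
apply: cvg_lim; first exact: norm_hausdorff.
exact: cvg_mx_entries.
Qed.

Lemma expmxE (R : realType) (N : nat) (A : 'M[R]_N) (i j : 'I_N) (t : R) :
  expmx (t *: A) i j = limn (pseries (expmx_coeff A i j) t).
Proof.
apply/esym/cvg_lim => //; under eq_cvg do rewrite -expmx_seriesE.
exact: expmx_entry_cvg.
Qed.

Lemma cvg_sum_ord (R : realType) (N : nat) (u : 'I_N -> R ^nat)
    (l : 'I_N -> R) :
  (forall i, u i n @[n --> \oo] --> l i) ->
  (\sum_i u i n) @[n --> \oo] --> \sum_i l i.
Proof.
move=> ul; apply: (@cvg_big _ _ _ _ xpredT) => //.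
exact: add_continuous.
Qed.

Lemma mulmx_expmx_cvg (R : realType) (N : nat) (X A : 'M[R]_N) (i j : 'I_N) :
  (X *m expmx_series A n) i j @[n --> \oo] --> (X *m expmx A) i j.
Proof.
rewrite mxE; under eq_cvg do rewrite mxE.
apply: cvg_sum_ord => l; apply: cvgM; first exact: cvg_cst.
exact: expmx_entry_cvg.
Qed.

Lemma expmx_mulmx_cvg (R : realType) (N : nat) (X A : 'M[R]_N) (i j : 'I_N) :
  (expmx_series A n *m X) i j @[n --> \oo] --> (expmx A *m X) i j.
Proof.
rewrite mxE; under eq_cvg do rewrite mxE.
apply: cvg_sum_ord => l; apply: cvgM; last exact: cvg_cst.
exact: expmx_entry_cvg.
Qed.

(** [X] commutes with every partial sum, and multiplication by [X] on either
    side is continuous. *)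
Lemma comm_expmx (R : realType) (N : nat) (X A : 'M[R]_N) :
  comm_mx X A -> comm_mx X (expmx A).
Proof.
move=> XA; apply/matrixP => i j.
rewrite -(cvg_lim _ (@mulmx_expmx_cvg R N X A i j))//.
rewrite -(cvg_lim _ (@expmx_mulmx_cvg R N X A i j))//.
congr (limn _); apply/funext => n; suff -> : comm_mx X (expmx_series A n) by [].
apply: comm_mx_sum => k _; rewrite /comm_mx -scalemxAr -scalemxAl.
congr (_ *: _); exact: (commrX k XA).
Qed.

Lemma expmx0 (R : realType) (N : nat) : expmx (0 : 'M[R]_N) = 1%:M.
Proof.
apply/matrixP => i j.
rewrite -(cvg_lim _ (@expmx_entry_cvg R N 0 i j))//.
apply: cvg_lim => //; rewrite -cvg_shiftS /=.
under eq_cvg => n.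
  rewrite /expmx_series /series /= big_nat_recl//= big1 => [|k _]; last first.
    by rewrite exprS mul0r scaler0.
  rewrite expr0 invr1 scale1r addr0; over.
exact: cvg_cst.
Qed.

(** * Derivative of the matrix exponential *)

(** The factor [X] makes the family of power series below stable under formal
    differentiation: [pseries_diffs] replaces [X] by [X *m A]. *)
Lemma pseries_mulmx (R : realType) (N : nat) (X A : 'M[R]_N)
    (i j : 'I_N) (t : R) :
  pseries (fun k => k`!%:R^-1 * (X *m A ^+ k) i j) t @ \oo -->
    (X *m expmx (t *: A)) i j.
Proof.
rewrite (_ : pseries _ _ = (fun n => (X *m expmx_series (t *: A) n) i j)).
  exact: mulmx_expmx_cvg.
apply/funext => n; rewrite /pseries /expmx_series /series /= mulmx_sumr summxE.
apply: eq_bigr => k _; rewrite exprZmx -!scalemxAr ![in RHS]mxE -mulrA.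
by rewrite (mulrC _ (t ^+ k)) !mxE.
Qed.

Lemma pseries_diffs_expmx (R : realType) (N : nat) (X A : 'M[R]_N)
    (i j : 'I_N) :
  pseries_diffs (fun k => k`!%:R^-1 * (X *m A ^+ k) i j) =
  (fun k => k`!%:R^-1 * ((X *m A) *m A ^+ k) i j).
Proof.
apply/funext => k; rewrite /pseries_diffs factS natrM invfM mulrA mulVKf//.
by rewrite exprS -mulmxE mulmxA.
Qed.

(** Termwise differentiation needs convergence of the series and of its first
    two formal derivatives, which are the series above for [X] equal to [1%:M],
    [A] and [A *m A]. *)
Lemma is_derive_expmx (R : realType) (N : nat) (A : 'M[R]_N)
    (i j : 'I_N) (t : R) :
  is_derive t 1 (fun s => expmx (s *: A) i j) ((A *m expmx (t *: A)) i j).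
Proof.
have coeffE : expmx_coeff A i j = fun k => k`!%:R^-1 * (1%:M *m A ^+ k) i j.
  by apply/funext => k; rewrite mul1mx.
have -> : (fun s => expmx (s *: A) i j) =
          (fun s => limn (pseries (expmx_coeff A i j) s)).
  by apply/funext => s; rewrite expmxE.
have diffsE : pseries_diffs (expmx_coeff A i j) =
              fun k => k`!%:R^-1 * (A *m A ^+ k) i j.
  by rewrite coeffE pseries_diffs_expmx mul1mx.
have <- : limn (pseries (pseries_diffs (expmx_coeff A i j)) t) =
          (A *m expmx (t *: A)) i j.
  by rewrite diffsE; apply: cvg_lim => //; exact: pseries_mulmx.
(* Any radius larger than [`|t|] would do: the series converge everywhere. *)
apply: (@pseries_snd_diffs _ _ (`|t| + 1)).
- exact: is_cvg_expmx_coeff.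
- by rewrite diffsE; apply: cvgP; exact: pseries_mulmx.
- by rewrite diffsE pseries_diffs_expmx; apply: cvgP; exact: pseries_mulmx.
- by rewrite [ltRHS]ger0_norm ?addr_ge0// ltrDl.
Qed.

Lemma is_derive_expmx_rev (R : realType) (N : nat) (A : 'M[R]_N)
    (i j : 'I_N) (T t : R) :
  is_derive t 1 (fun s => expmx ((T - s) *: A) i j)
    ((- (A *m expmx ((T - t) *: A))) i j).
Proof.
have dT : is_derive t 1 (fun s : R => T - s) (-1).
  by apply: is_derive_eq; rewrite add0r mul1r.
have := @is_derive1_comp _ (fun u => expmx (u *: A) i j) (fun s => T - s) t _ _
  (is_derive_expmx A i j (T - t)) dT.
by move=> /is_derive_eq; apply; rewrite [RHS]mxE mulrN1.
Qed.

Lemma is_derive_mulmx (R : realType) (m n p : nat)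
    (X : R -> 'M[R]_(m, n)) (Y : R -> 'M[R]_(n, p))
    (X' : 'M[R]_(m, n)) (Y' : 'M[R]_(n, p)) (t : R) :
  (forall i j, is_derive t 1 (fun s => X s i j) (X' i j)) ->
  (forall i j, is_derive t 1 (fun s => Y s i j) (Y' i j)) ->
  forall i j, is_derive t 1 (fun s => (X s *m Y s) i j)
    ((X' *m Y t + X t *m Y') i j).
Proof.
move=> dX dY i j.
have -> : (fun s => (X s *m Y s) i j) =
          \sum_l ((fun s => X s i l) * (fun s => Y s l j)).
  by apply/funext => s; rewrite mxE fct_sumE.
apply: is_derive_eq; rewrite !mxE -big_split/=; apply: eq_bigr => l _.
by rewrite addrC; congr (_ + _); exact: mulrC.
Qed.

(** * Positivity of the exponential of a Metzler matrix *)

(** With [E s = expmx ((1 - s) *: A)] and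
    [F s = expR (- c * s) *: expmx (s *: (A + c%:M))], one has [E' = - A *m E]
    and [F' = A *m F], so [E *m F] is constant because [A] commutes with [E];
    comparing its values at [0] and [1] gives the identity without multiplying
    two series. *)
Lemma expmx_shift (R : realType) (N : nat) (A : 'M[R]_N) (c : R) :
  expmx (A + c%:M) = expR c *: expmx A.
Proof.
pose E (s : R) := expmx ((1 - s) *: A).
pose F (s : R) : 'M[R]_N := expR (- c * s) *: expmx (s *: (A + c%:M)).
have dF (t : R) i j : is_derive t 1 (fun s => F s i j) ((A *m F t) i j).
  have de : is_derive t 1 (fun s : R => expR (- c * s)) (expR (- c * t) * - c).
    have dl : is_derive t 1 (fun s : R => - c * s) (- c).
      by apply: is_derive_eq; rewrite [LHS]mulr1.
    exact: (@is_derive1_comp _ expR (fun s => - c * s) t _ _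
              (is_derive_expR (- c * t)) dl).
  have -> : (fun s => F s i j) = (fun s => expR (- c * s)) *
                                 (fun s => expmx (s *: (A + c%:M)) i j).
    by apply/funext => s; rewrite mxE.
  have dP := is_derive_expmx (A + c%:M) i j t.
  apply: is_derive_eq.
  rewrite /F -scalemxAr mulmxDl mul_scalar_mx !mxE;
    rewrite /GRing.scale /=; ring.
have EF_cst : E 0 *m F 0 = E 1 *m F 1.
  apply/matrixP => i j.
  apply: (@is_derive_0_is_cst R (fun s => (E s *m F s) i j)).
  move=> t.
  have := is_derive_mulmx (fun k l => is_derive_expmx_rev A k l 1 t) (dF t) i j.
  move=> /is_derive_eq; apply.
  rewrite -/(E t) mulNmx mulmxA.
  have -> : A *m E t = E t *m A.
    by apply: comm_expmx; rewrite /comm_mx -scalemxAr -scalemxAl.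
  by rewrite addNr mxE.
move: EF_cst; rewrite /E /F subr0 subrr !scale0r !scale1r expmx0 mulr0 expR0.
rewrite scale1r mulmx1 mul1mx mulr1 => ->.
by rewrite scalerA -expRD subrr expR0 scale1r.
Qed.

(** All terms of the series are nonnegative and the first one is the
    identity. *)
Lemma expmx_ge_id (R : realType) (N : nat) (A : 'M[R]_N) :
  (forall i j, 0 <= A i j) -> forall i j, (i == j)%:R <= expmx A i j.
Proof.
move=> A_ge0 i j.
have pow_ge0 k i' j' : 0 <= (A ^+ k) i' j'.
  elim: k i' j' => [|k IH] i' j'; first by rewrite expr0 mxE ler0n.
  by rewrite exprS -mulmxE mxE sumr_ge0// => l _; rewrite mulr_ge0.
rewrite -(cvg_lim _ (@expmx_entry_cvg R N A i j))//.
apply: limr_ge; first by apply: cvgP; exact: expmx_entry_cvg.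
exists 1%N => // n /= n_gt0; rewrite /expmx_series /series /= summxE.
rewrite big_ltn// expr0 invr1 scale1r mxE lerDl sumr_ge0// => k _.
by rewrite mxE mulr_ge0// invr_ge0.
Qed.

(** The shift by [c = \sum_i `|A i i|] makes the diagonal nonnegative as well;
    the resulting constant is [expR (- c)]. *)
Lemma expmx_Metzler (R : realType) (N : nat) (A : 'M[R]_N) :
  (forall i j, i != j -> 0 <= A i j) ->
  exists2 a : R, 0 < a & forall i j, a * (i == j)%:R <= expmx A i j.
Proof.
move=> A_off; pose c := \sum_i `|A i i|.
exists (expR (- c)); first exact: expR_gt0.
move=> i j; rewrite -ler_pdivlMl ?expR_gt0// -expRN opprK.
have -> : expR c * expmx A i j = expmx (A + c%:M) i j.
  by rewrite expmx_shift mxE.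
apply: expmx_ge_id => {i j} i j; rewrite !mxE.
have [<-|ij] := eqVneq i j; last by rewrite addr0 A_off.
rewrite mulr1n /c (bigD1 i)//= addrA addr_ge0 ?sumr_ge0//.
by rewrite -lerBlDl sub0r -normrN ler_norm.
Qed.

(** * Derivative relative to a set *)

(** Carathéodory's form of differentiability, [f s - f t = g s * (s - t)] with
    [g] continuous at [t], identifies the difference quotient with [g] off [t];
    its limit then survives restriction to [D]. *)
Lemma is_derive_has_derivative_in (R : realType) (D : set R) (f : R -> R)
    (t l : R) :
  is_derive t 1 f l -> has_derivative_in D f t l.
Proof.
move=> /is_derive1_caratheodory[g [fE g_cont <-]].
have g_cvg : g s @[s --> within D t^'] --> g t.
  apply: cvg_trans g_cont; apply: cvg_app.
  exact: cvg_trans (@cvg_within _ _ _ _) (@cvg_within _ _ _ _).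
apply: cvg_trans g_cvg; apply: near_eq_cvg.
have t'P : \forall s \near within D t^', s != t.
  by apply: cvg_within; exact: withinT.
near=> s; have st : s != t by near: s.
by rewrite /= fE mulfK// subr_eq0.
Unshelve. all: by end_near. Qed.

(** * The logarithmic equation *)

(** The diagonal entry of the generator is minus the sum of the off-diagonal
    entries of its row, so it collects the terms [- lam i j * x i]. *)
Lemma generator_mulmx (R : realType) (N : nat) (V : 'I_N -> {set 'I_N})
    (lam : 'I_N -> 'I_N -> R) (x : 'cV[R]_N) (i : 'I_N) :
  i \notin V i ->
  (generator V lam *m x) i ord0 =
  \sum_(j in V i) lam i j * (x j ord0 - x i ord0).
Proof.
move=> iVi; rewrite mxE (bigD1 i)//= mxE (negbTE iVi) eqxx.
under [RHS]eq_bigr do rewrite mulrBr.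
rewrite sumrB -mulr_suml mulNr addrC; congr (_ - _).
rewrite [RHS]big_mkcond/= [RHS](bigD1 i)//= (negbTE iVi) add0r.
apply: eq_bigr => j ji; rewrite mxE; case: ifP => // _.
by rewrite (negbTE ji) mul0r.
Qed.

Theorem theorem1 (R : realType) (T : R) (N : nat) (V : 'I_N -> {set 'I_N})
    (r g : 'I_N -> R) (lam : 'I_N -> 'I_N -> R) :
  0 < T ->
  (2 <= N)%N ->
  (forall i, i \notin V i) ->
  (forall i j, j \in V i -> 0 < lam i j) ->
  let B : 'M[R]_N := diag_mx (\row_i r i) + generator V lam in
  let gfrak : 'cV[R]_N := \col_i expR (g i) in
  let w : R -> 'cV[R]_N := fun t => expmx ((T - t) *: B) *m gfrak in
  let v : R -> 'I_N -> R := fun t i => ln (w t i ord0) in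
  [/\ forall (i : 'I_N) (t : R), t \in `[0, T] -> 0 < w t i ord0,
      forall (i : 'I_N) (t : R), t \in `[0, T] ->
        has_derivative_in `[0, T] (fun s => v s i) t
          (- r i - \sum_(j in V i) lam i j * (expR (v t j - v t i) - 1))
    & forall i : 'I_N, v T i = g i].
Proof.
move=> T_gt0 N_ge2 V_irr lam_gt0 B gfrak w v.
have B_off i j : i != j -> 0 <= B i j.
  move=> ij; rewrite !mxE (negbTE ij) mulr0n add0r eq_sym (negbTE ij).
  by case: ifP => // /lam_gt0/ltW.
have w_gt0 i t : t \in `[0, T] -> 0 < w t i ord0.
  rewrite in_itv/= => /andP[_ tT].
  have [|a a_gt0 aE] := @expmx_Metzler R N ((T - t) *: B).
    by move=> k l kl; rewrite mxE mulr_ge0 ?B_off// subr_ge0.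
  rewrite mxE (bigD1 i)//= ltr_pwDl//.
    rewrite mxE mulr_gt0 ?expR_gt0//.
    by rewrite (lt_le_trans _ (aE i i))// eqxx mulr1.
  apply: sumr_ge0 => j _; rewrite mxE mulr_ge0 ?expR_ge0//.
  by rewrite (le_trans _ (aE i j))// mulr_ge0// ltW.
have w_derive i (t : R) :
    is_derive t 1 (fun s => w s i ord0) (- (B *m w t) i ord0).
  have dg k l : is_derive t 1 (fun _ : R => gfrak k l) ((0 : 'cV[R]_N) k l).
    by rewrite [X in is_derive _ _ _ X]mxE; exact: is_derive_cst.
  have := is_derive_mulmx (fun k l => is_derive_expmx_rev B k l T t) dg i ord0.
  by move=> /is_derive_eq; apply; rewrite mulmx0 addr0 mulNmx -mulmxA mxE.
split=> //.
- move=> i t tT; apply: is_derive_has_derivative_in.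
  have wi_gt0 := w_gt0 i t tT.
  have := @is_derive1_comp _ (@ln R) (fun s => w s i ord0) t _ _
    (is_derive1_ln wi_gt0) (w_derive i t).
  move=> /is_derive_eq; apply.
  have expv j : expR (v t j - v t i) = w t j ord0 / w t i ord0.
    by rewrite expRB !lnK// posrE w_gt0.
  under eq_bigr do rewrite expv.
  have -> : (B *m w t) i ord0 = r i * w t i ord0 +
      \sum_(j in V i) lam i j * (w t j ord0 - w t i ord0).
    by rewrite /B mulmxDl mxE generator_mulmx// mul_diag_mx mxE [X in X * _]mxE.
  rewrite mulrN mulrDr opprD mulrCA mulVf ?gt_eqF// mulr1; congr (_ - _).
  rewrite mulr_sumr; apply: eq_bigr => j _.
  by rewrite mulrCA mulrBr mulVf ?gt_eqF// [_^-1 * _]mulrC.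
- move=> i; rewrite /v /w subrr scale0r expmx0 mul1mx mxE; exact: expRK.
Qed.
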